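(* If $6$ points in $\mathbb{R}^3$ are such that no $4$ of them lie in one plane, then there are two linked triangles with vertices at these $6$ points.
   Context: A triangle is the part of a plane bounded by a closed polygonal line of three segments; this polygonal line is called the outline of the triangle. Two triangles in $\mathbb{R}^3$, no $4$ of whose $6$ vertices lie in one plane, are called linked if the outline of the first triangle intersects the second triangle at exactly one point. (This property is symmetric in the two triangles.) In particular, two linked triangles with vertices at the $6$ given points have disjoint vertex sets, forming a splitting of the $6$ points into two triples. *)

(* Defs.v *)
From mathcomp Require Import all_boot all_order all_algebra.
From mathcomp Require Import classical_sets reals.

Set Implicit Arguments.
Unset Strict Implicit.
Unset Printing Implicit Defensive.

Import Order.TTheory GRing.Theory Num.Theory.

Local Open Scope classical_set_scope.
Local Open Scope ring_scope.

Definition is_plane (R : realType) (P : set 'rV[R]_3) : Prop :=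
  exists (n : 'rV[R]_3) (c : R),
    n != 0 /\ P = [set x : 'rV[R]_3 | \sum_(k < 3) n 0 k * x 0 k = c].

(* Quantifying over sets of indices rather than of points means that, when
   #|I| >= 4, two equal points p i = p j violate the condition: any four
   indices including i and j give at most three points, hence a coplanar
   set.  So the points of the family are then automatically distinct. *)
Definition no_four_coplanar (R : realType) (I : finType)
    (p : I -> 'rV[R]_3) : Prop :=
  forall A : {set I}, #|A| = 4 ->
    ~ exists P : set 'rV[R]_3, is_plane P /\ forall i, i \in A -> P (p i).

Definition segment (R : realType) (a b : 'rV[R]_3) : set 'rV[R]_3 :=
  [set x | exists t : R, 0 <= t <= 1 /\ x = (1 - t) *: a + t *: b].

(* A triangle is given by its vertices T : 'I_3 -> R^3; ordS is the cyclic
   successor on 'I_3, so the sides are T 0 T 1, T 1 T 2 and T 2 T 0. *)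
Definition outline (R : realType) (T : 'I_3 -> 'rV[R]_3) : set 'rV[R]_3 :=
  \bigcup_i segment (T i) (T (ordS i)).

(* The closed solid triangle: the convex combinations of the vertices. *)
Definition triangle (R : realType) (T : 'I_3 -> 'rV[R]_3) : set 'rV[R]_3 :=
  [set x | exists w : 'I_3 -> R,
    [/\ forall i, 0 <= w i, \sum_i w i = 1 & x = \sum_i w i *: T i]].

Definition six_vertices (R : realType) (T U : 'I_3 -> 'rV[R]_3)
    (v : 'I_3 + 'I_3) : 'rV[R]_3 :=
  match v with inl i => T i | inr i => U i end.

Definition linked (R : realType) (T U : 'I_3 -> 'rV[R]_3) : Prop :=
  no_four_coplanar (six_vertices T U) /\
  exists x, outline T `&` triangle U = [set x].

(* Main.v *)
Require Import Defs.
From mathcomp Require Import all_boot all_order all_algebra.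
From mathcomp Require Import classical_sets reals.
From mathcomp Require Import ring lra zify.

Set Implicit Arguments.
Unset Strict Implicit.
Unset Printing Implicit Defensive.

Import Order.TTheory GRing.Theory Num.Theory.

Local Open Scope ring_scope.

(** Write an affine dependency of the six points p k as a family of weights c k
    with sum 0 and with the sum of the c k *: p k equal to 0.  Two facts
    translate the geometry into signs of dependencies.  The dependencies form
    a space of dimension at least 2, and a dependency with two zeros would
    make the four other points coplanar unless it vanishes
    ([affine_dep_two_zeros]); so any two independent dependencies span all of
    them.  A point common to two solid triangles T and U on the six points is
    a dependency that is nonnegative on T and nonpositive on U; it lies on the
    outline of T when one of the weights on T is 0.

    In the plane of dependencies, those with sign pattern +++ on T and --- on
    U, if any, form an open sector (T and U then meet in a segment), and on
    each of its two boundary rays exactly one weight vanishes.  The outline of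
    T meets the triangle U in as many points as there are boundary rays whose
    zero is at a vertex of T.  So T and U are linked exactly when one ray has
    its zero in T and the other its zero in U ([linked_of_deps]).

    It remains to find such a sector.  Turn a dependency with more positive
    than negative weights, and no zero, continuously into its opposite.  The
    number of positive weights changes by one at each zero that is crossed,
    and it has to pass from at least 4 to at most 2.  At a place where it goes
    from 4 to 3 and then to 2, the sector of patterns 3|3 in between is
    entered by the loss of one positive weight, at the index i, and left by
    the loss of another one, at j.  Then i lies on the negative side U and j
    on the positive side T, which is the required position.
    [sign_crossing] is this intermediate value argument. *)

(** * Affine dependencies *)

Definition affine_dep (R : pzRingType) (I : finType) (p : I -> 'rV[R]_3)
    (c : I -> R) : Prop :=
  \sum_i c i = 0 /\ \sum_i c i *: p i = 0.

Lemma affine_depZ (R : comPzRingType) (I : finType) (p : I -> 'rV[R]_3)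
    (c : I -> R) (x : R) :
  affine_dep p c -> affine_dep p (fun i => x * c i).
Proof.
move=> [sc vc]; split; first by rewrite -mulr_sumr sc mulr0.
by under eq_bigr do rewrite -scalerA; rewrite -scaler_sumr vc scaler0.
Qed.

Lemma affine_dep_comb (R : comPzRingType) (I : finType) (p : I -> 'rV[R]_3)
    (c d : I -> R) (x y : R) :
  affine_dep p c -> affine_dep p d ->
  affine_dep p (fun i => x * c i + y * d i).
Proof.
move=> /(affine_depZ x)[sc vc] /(affine_depZ y)[sd vd]; split.
  by rewrite big_split /= sc sd addr0.
by under eq_bigr do rewrite scalerDl; rewrite big_split /= vc vd addr0.
Qed.

Lemma affine_dep_bij (R : pzRingType) (I J : finType) (f : J -> I)
    (p : I -> 'rV[R]_3) (c : I -> R) :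
  bijective f -> affine_dep p c -> affine_dep (p \o f) (c \o f).
Proof.
move=> bijf [sc vc]; have onf : {on predT, bijective f} by exact: onW_bij.
by split; [rewrite -[RHS]sc | rewrite -[RHS]vc]; rewrite [RHS](reindex f onf).
Qed.

Lemma linear_dep (R : fieldType) (n : nat) (I : finType) (h : I -> 'rV[R]_n) :
  (n < #|I|)%N -> exists c, \sum_i c i *: h i = 0 /\ exists k, c k != 0.
Proof.
move=> ltnI; pose M : 'M_(#|I|, n) := \matrix_r h (enum_val r).
have kM : kermx M != 0.
  by rewrite kermx_eq0 /row_free neq_ltn (leq_ltn_trans (rank_leq_col M)).
have /rowV0Pn[v /sub_kermxP vM v0] := kM.
have [r vr] := rV0Pn _ v0.
exists (fun i => v 0 (enum_rank i)); split; last first.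
  by exists (enum_val r); rewrite enum_valK.
rewrite -[RHS]vM mulmx_sum_row [RHS](reindex _ (onW_bij _ (enum_rank_bij I))).
by apply: eq_bigr => i _; rewrite rowK enum_rankK.
Qed.

(** Being an affine dependency with [c i = 0] amounts to 3 + 1 + 1 linear
    equations: three coordinates, the sum of the weights, and the zero. *)
Lemma affine_dep_at (R : fieldType) (I : finType) (p : I -> 'rV[R]_3) (i : I) :
  (5 < #|I|)%N -> exists c, [/\ affine_dep p c, c i = 0 & exists k, c k != 0].
Proof.
pose h k : 'rV[R]_(3 + (1 + 1)) := row_mx (p k) (row_mx 1 (k == i)%:R%:M).
move=> /(linear_dep h)[c [hc nzc]]; exists c.
have entry j : \sum_k c k * h k 0 j = 0.
  have /rowP/(_ j) := hc; rewrite summxE mxE => hj; rewrite -[RHS]hj.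
  by apply: eq_bigr => k _; rewrite [RHS]mxE.
split => //.
  split; last first.
    apply/rowP => j; rewrite summxE mxE -[RHS](entry (lshift _ j)).
    by apply: eq_bigr => k _; rewrite row_mxEl mxE.
  rewrite -[RHS](entry (rshift _ (lshift _ 0))).
  by apply: eq_bigr => k _; rewrite row_mxEr row_mxEl mxE mulr1.
rewrite -[RHS](entry (rshift _ (rshift _ 0))) (bigD1 i) //=.
by rewrite big1 ?addr0 => [|k /negPf ki];
  rewrite row_mxEr row_mxEr mxE ?eqxx ?ki ?mulr1 ?mulr0.
Qed.

(** Four points with a nontrivial affine dependency are coplanar: the rows
    (p k, 1) form a square matrix with nonzero left kernel, hence with a
    nonzero right kernel, which is the equation of a plane. *)
Lemma affine_dep_coplanar (R : realType) (I : finType) (p : I -> 'rV[R]_3)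
    (c : I -> R) (A : {set I}) :
  no_four_coplanar p -> #|A| = 4%N -> affine_dep p c ->
  (forall k, k \notin A -> c k = 0) -> forall k, c k = 0.
Proof.
move=> hp cA [sc vc] supp k.
apply/eqP; apply/negPn/negP => ck.
have kA : k \in A by apply: contraTT ck => /supp ->; rewrite eqxx.
pose M : 'M[R]_(#|A|, 3 + 1) := \matrix_r row_mx (p (enum_val r)) 1.
have vM : (\row_r c (enum_val r)) *m M = 0.
  rewrite mulmx_sum_row.
  under eq_bigr do rewrite mxE rowK.
  rewrite -(big_enum_val (fun i => c i *: row_mx (p i) 1)).
  have -> : \sum_(i in A) c i *: row_mx (p i) (1 : 'M_1) =
            \sum_i c i *: row_mx (p i) 1.
    rewrite [RHS](bigID (mem A)) /= [X in _ + X]big1 ?addr0 // => i /supp ->.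
    by rewrite scale0r.
  apply/rowP => j; rewrite summxE mxE -(splitK j); case: (split j) => l /=.
    have /rowP/(_ l) := vc; rewrite summxE mxE => vl; rewrite -[RHS]vl.
    by apply: eq_bigr => i _; rewrite mxE row_mxEl mxE.
  rewrite -[RHS]sc; apply: eq_bigr => i _.
  by rewrite mxE row_mxEr !ord1 mxE mulr1.
have : kermx M^T != 0.
  rewrite kermx_eq0 -row_leq_rank mxrank_tr; apply/negP => rM.
  have /row_free_inj : row_free M by rewrite -row_leq_rank [X in (X <= _)%N]cA.
  move=> /(_ 1 (\row_r c (enum_val r)) 0); rewrite vM mul0mx.
  move=> /(_ erefl)/rowP/(_ (enum_rank_in kA k)).
  by rewrite !mxE enum_rankK_in // => /eqP; rewrite (negPf ck).
(* A vector (n, d) of the right kernel gives the plane n . x = - d. *)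
move=> /rowV0Pn[v /sub_kermxP]; rewrite -[v]hsubmxK [rsubmx v]mx11_scalar.
move: (lsubmx v) (rsubmx v 0 0) => n d nM nd0.
have plane i : i \in A -> \sum_l n 0 l * p i 0 l = - d.
  move=> iA; have /rowP/(_ (enum_rank_in iA i)) := nM.
  have ME l : M^T l (enum_rank_in iA i) = row_mx (p i) 1 0 l.
    by rewrite !mxE enum_rankK_in.
  rewrite mxE [RHS]mxE big_split_ord /= big_ord1 ME !row_mxEr => /eqP.
  rewrite addr_eq0 !mxE mulr1 => /eqP <-.
  by apply: eq_bigr => l _; rewrite ME !row_mxEl.
apply: (hp A cA).
exists [set x | \sum_l n 0 l * x 0 l = - d]%classic.
split; last exact: plane.
exists n, (- d); split => //.
(* If n = 0, the equation at p k forces d = 0. *)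
apply: contraNneq nd0 => n0; have := plane _ kA; rewrite n0.
rewrite big1 => [/eqP|i _]; last by rewrite mxE mul0r.
by rewrite eq_sym oppr_eq0 => /eqP ->; rewrite raddf0 row_mx0.
Qed.

Lemma affine_dep_two_zeros (R : realType) (I : finType) (p : I -> 'rV[R]_3)
    (c : I -> R) (i j : I) :
  no_four_coplanar p -> #|I| = 6%N -> affine_dep p c ->
  i != j -> c i = 0 -> c j = 0 -> forall k, c k = 0.
Proof.
move=> hp cI dc ij ci cj.
apply: (@affine_dep_coplanar _ _ p _ (~: [set i; j])) => //.
  by have := cardsC [set i; j]; rewrite cI cards2 ij => /(@addnI 2 _ 4).
by move=> k; rewrite !inE negbK => /orP[] /eqP ->.
Qed.

(** * Rotating a dependency *)

(** The family [k |-> s k * (r k - t)], with [t] running over the reals, is a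
    pencil of dependencies that goes from the direction of [s] to that of [-s],
    and [P i] collects the positive weights of its member that vanishes at [i].
    As [t] grows, the zeros are met in the order of the values of [r]; the size
    of [P i] exceeds [m] at the first zero and is at most [m] at the last one.
    Take for [i] the last zero where it exceeds [m], and for [j] the next zero.
    No weight other than those at [i] and [j] changes its sign in between, so
    the only way for the size to drop is that [P i] loses [j] and that [i] does
    not enter. *)
Lemma sign_crossing (R : realFieldType) (I : finType) (m : nat) (s r : I -> R) :
    injective r -> (#|[set k | (s k < 0)%R]| <= m)%N ->
    (m.+1 < #|[set k | (0 < s k)%R]|)%N ->
  let P i := [set k | 0 < s k * (r k - r i)] in
  exists i j, [/\ P i = j |: P j, i \notin P j & #|P j| = m].
Proof.
move=> injr hneg hpos P.
have [i0 _] : exists i0, i0 \in [set k | 0 < s k].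
  by apply/set0Pn; rewrite -cards_eq0 -lt0n (leq_trans _ hpos).
have Pmin : (m < #|P [arg min_(i < i0) r i]%O|)%N.
  case: arg_minP => // i _ le_i.
  have sub : ([set k | 0 < s k] \subset i |: P i).
    apply/fintype.subsetP => k; rewrite !inE => sk; case: eqVneq => //= ki.
    rewrite pmulr_rgt0 // subr_gt0 lt_neqAle le_i // andbT.
    by rewrite (inj_eq injr) eq_sym.
  have := leq_trans hpos (subset_leq_card sub).
  by rewrite cardsU1; case: (_ \notin _) => /=; lia.
case: (@arg_maxP _ _ _ _ (fun i => m < #|P i|)%N r Pmin) => i Pi maxi.
have [j0 ij0] : exists j, r i < r j.
  apply/existsP; rewrite -[X in is_true X]negbK negb_exists.
  apply/negP => /forallP le_i.
  suff : (#|P i| <= m)%N by rewrite leqNgt Pi.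
  apply: leq_trans hneg; apply/subset_leq_card/fintype.subsetP => k.
  rewrite !inE.
  have := le_i k; rewrite -leNgt -subr_le0 le_eqVlt => /orP[/eqP->|].
    by rewrite mulr0 ltxx.
  by move=> h; rewrite nmulr_lgt0.
case: (@arg_minP _ _ _ _ (fun j => r i < r j) r ij0) => j ij minj.
have Pj : (#|P j| <= m)%N.
  by rewrite leqNgt; apply/negP => /maxi /=; rewrite leNgt ij.
have Pij : (P i :\ j = P j :\ i).
  apply/setP => k; rewrite !inE; case: (eqVneq k j) => [->|kj] /=.
    by rewrite subrr mulr0 ltxx andbF.
  case: (eqVneq k i) => [->|ki] /=; first by rewrite subrr mulr0 ltxx.
  have [ik|] := ltP (r i) (r k).
    have jk : r j < r k by rewrite lt_neqAle minj // andbT (inj_eq injr) eq_sym.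
    by rewrite !pmulr_lgt0 ?subr_gt0.
  rewrite le_eqVlt (inj_eq injr) (negPf ki) /= => ki'.
  by rewrite !nmulr_lgt0 ?subr_lt0 ?(lt_trans ki' ij).
have cPi := cardsD1 j (P i); have cPj := cardsD1 i (P j).
(* Counting leaves only the case where j lies in P i and i not in P j. *)
exists i, j; move: cPi cPj; rewrite Pij.
case: (boolP (j \in P i)) => jPi; case: (boolP (i \in P j)) => iPj /=;
  move=> cPi cPj; try by (exfalso; move: Pi Pj; lia).
split=> //; last by move: Pi Pj; lia.
have jPj : P j :\ i = P j.
  by apply/finset.setDidPl; rewrite disjoint_sym disjoints1.
by rewrite -jPj -Pij finset.setD1K.
Qed.

Lemma card_sign (R : realDomainType) (I : finType) (c : I -> R) :
  (#|[set k | (0 < c k)%R]| + #|[set k | (c k < 0)%R]| +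
   #|[set k | c k == 0%R]| = #|I|)%N.
Proof.
rewrite -!sum1dep_card -sum1_card big_mkcond [X in (_ + X + _)%N]big_mkcond.
rewrite [X in (_ + _ + X)%N]big_mkcond -!big_split /=.
by apply: eq_bigr => k _; case: ltgtP.
Qed.

(** Start from a dependency [d] that vanishes at one index [i]: up to sign it
    has at most two negative weights among the five others.  Adding a
    dependency that is positive at [i] to a large multiple of [d] makes the
    weight at [i] positive and keeps the other signs, so no zero is left.
    The zeros [c k / e k] of the pencil spanned by [c] and this new dependency
    are distinct because no dependency has two zeros. *)
Lemma affine_dep_few_neg (R : realType) (I : finType) (p : I -> 'rV[R]_3) :
  no_four_coplanar p -> #|I| = 6%N ->
  exists c d, [/\ affine_dep p c, affine_dep p d, forall k, d k != 0,
    injective (fun k => c k / d k) & (#|[set k | (d k < 0)%R]| <= 2)%N].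
Proof.
move=> hp cI.
have five : (5 < #|I|)%N by rewrite cI.
have : (1 < #|I|)%N by rewrite cI.
move=> /card_gt1P[i [j [_ _ ij]]].
have zero_at c k l : affine_dep p c -> c k = 0 -> (exists k, c k != 0) ->
    l != k -> c l != 0.
  move=> dc ck [n cn] lk; apply: contraNneq cn => cl.
  by rewrite (affine_dep_two_zeros hp cI dc lk).
(* The five nonzero weights cannot split evenly; choose the sign. *)
have [d [dd di d1]] : exists d, [/\ affine_dep p d, d i = 0 &
    (exists k, d k != 0) /\ (#|[set k | (d k < 0)%R]| <= 2)%N].
  have [d [dd di d1]] := affine_dep_at p i five.
  have := card_sign d; rewrite cI.
  have -> : [set k | d k == 0] = [set i].
    apply/setP => k; rewrite !inE.
    have [->|ki] := eqVneq k i; first by rewrite di eqxx.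
    by rewrite (negPf (zero_at _ _ _ dd di d1 ki)).
  rewrite cards1 => cd.
  have [small|large] := leqP #|[set k | (d k < 0)%R]| 2; first by exists d.
  exists (fun k => -1 * d k); split; first exact: affine_depZ.
    by rewrite di mulr0.
  split; first by have [k dk] := d1; exists k; rewrite mulN1r oppr_eq0.
  have -> : [set k | -1 * d k < 0] = [set k | 0 < d k].
    by apply/setP => k; rewrite !inE mulN1r oppr_lt0.
  by move: cd large; move: #|_| #|_| => x y; lia.
case: d1 => d1 dneg.
have [c [dc cj ci]] : exists c, [/\ affine_dep p c, c j = 0 & 0 < c i].
  have [c [dc cj c1]] := affine_dep_at p j five.
  exists (fun k => (c i)^-1 * c k); split; first exact: affine_depZ.
    by rewrite cj mulr0.
  by rewrite mulVf ?ltr01 // (zero_at _ _ _ dc cj c1).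
(* K exceeds every ratio |c k / d k|, so K d + c has the signs of d wherever
   d does not vanish. *)
pose K := 1 + \sum_k `|c k / d k|.
pose e k := K * d k + 1 * c k.
have eE k : k != i -> e k = d k * (K + c k / d k).
  move=> ki; rewrite /e; have dk := zero_at _ _ _ dd di d1 ki.
  by field.
have Kc k : 0 < K + c k / d k.
  rewrite -[_ / _]opprK subr_gt0 (le_lt_trans (ler_norm _)) // normrN.
  by rewrite /K (bigD1 k) //= addrCA ltrDl ltr_wpDr ?sumr_ge0 ?ltr01.
have ei : 0 < e i by rewrite /e di mulr0 add0r mul1r.
have e0 k : e k != 0.
  have [->|ki] := eqVneq k i; first by rewrite gt_eqF.
  by rewrite eE // mulf_neq0 ?(zero_at _ _ _ dd di d1) // gt_eqF.
have de : affine_dep p e by exact: affine_dep_comb.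
exists c, e; split => //.
  (* If the ratios agree at k and l, then g has two zeros, so c is the
     multiple c k / e k of e; but c vanishes at j and e does not. *)
  move=> k l /= kl; apply: contraTeq ci => nkl.
  pose g n := 1 * c n + (- (c k / e k)) * e n.
  have dg : affine_dep p g by exact: affine_dep_comb.
  have gk : g k = 0 by rewrite /g; field.
  have gl : g l = 0 by rewrite /g kl; field.
  have g0 := affine_dep_two_zeros hp cI dg nkl gk gl.
  have r0 : c k / e k = 0.
    have := g0 j; rewrite /g cj mulr0 add0r => /eqP.
    by rewrite mulf_eq0 (negPf (e0 j)) orbF oppr_eq0 => /eqP.
  by have := g0 i; rewrite /g r0 oppr0 mul0r addr0 mul1r => ->; rewrite ltxx.
apply: leq_trans dneg; apply/subset_leq_card/fintype.subsetP => k; rewrite !inE.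
have [->|ki] := eqVneq k i; first by rewrite ltNge ltW.
by rewrite eE // pmulr_llt0.
Qed.

(** * Linked triangles from dependencies *)

Lemma no_four_coplanar_inj (R : realType) (I J : finType) (f : J -> I)
    (p : I -> 'rV[R]_3) (q : J -> 'rV[R]_3) :
  injective f -> q =1 p \o f -> no_four_coplanar p -> no_four_coplanar q.
Proof.
move=> injf qE hp A cA [P [planeP inP]]; apply: (hp (f @: A)).
  by rewrite card_imset.
by exists P; split=> // _ /imsetP[k kA ->]; have := inP k kA; rewrite qE.
Qed.

Lemma outlineP (R : realType) (T : 'I_3 -> 'rV[R]_3) (x : 'rV[R]_3) :
  outline T x <-> exists w : 'I_3 -> R,
    [/\ forall i, 0 <= w i, \sum_i w i = 1, x = \sum_i w i *: T i
      & exists k, w k = 0].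
Proof.
have sum3 (V : nmodType) (F : 'I_3 -> V) i :
    \sum_k F k = F i + F (ordS i) + F (ordS (ordS i)).
  have nS : ordS i != i by case: i => [[|[|[]]]].
  have nSS : (ordS (ordS i) != i) && (ordS (ordS i) != ordS i).
    by case: i {nS} => [[|[|[]]]].
  rewrite (bigD1 i) //= (bigD1 (ordS i)) //= (bigD1 (ordS (ordS i))) //=.
  rewrite big1 ?addr0 ?addrA // => j.
  by case: i j {nS nSS} => [[|[|[]]]] // ? [[|[|[]]]].
split.
  move=> [i _ [t [/andP[t0 t1] ->]]].
  have nS : (ordS i == i) = false by case: i => [[|[|[]]]].
  have nSS : (ordS (ordS i) == i) = false by case: i {nS} => [[|[|[]]]].
  exists (fun k => if k == i then 1 - t else if k == ordS i then t else 0).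
  split; rewrite ?(sum3 _ _ i) ?eqxx ?nS ?nSS ?(inj_eq (@ordS_inj _)) ?nS.
  - by move=> k; case: ifP => _; [rewrite subr_ge0 | case: ifP].
  - by rewrite addr0 subrK.
  - by rewrite scale0r addr0.
  - by exists (ordS (ordS i)); rewrite nSS (inj_eq (@ordS_inj _)) nS.
move=> [w [w0 w1 -> [k wk]]].
exists (ordS k) => //; exists (w (ordS (ordS k))).
move: w1; rewrite !(sum3 _ _ k) wk scale0r !add0r => w1.
split; last by rewrite -w1 addrK.
by rewrite w0 -w1 lerDr w0.
Qed.

(** The dependency [d] gives a point on the side of [T] opposite to [T a].  It
    is the only one: a common point of the outline of [T] and the triangle [U]
    is a dependency [y c + z d] with a zero on [T], and its signs at [inl a] and
    [inr b] give [y, z >= 0].  The weights of [c] on [T] are positive and those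
    of [d] are nonnegative, so the zero forces [y = 0]. *)
Lemma linked_of_deps (R : realType) (T U : 'I_3 -> 'rV[R]_3) (a b : 'I_3)
    (c d : 'I_3 + 'I_3 -> R) (q := six_vertices T U) :
    no_four_coplanar q -> affine_dep q c -> affine_dep q d ->
    (forall k, 0 < c (inl k)) -> c (inr b) = 0 ->
    d (inl a) = 0 -> (forall k, k != a -> 0 < d (inl k)) ->
    (forall k, d (inr k) < 0) ->
  linked T U.
Proof.
move=> hq dc dd cT cb da dT dU; split=> //.
have d0 k : 0 <= d (inl k).
  by have [->|/dT/ltW//] := eqVneq k a; rewrite da.
pose S := \sum_k d (inl k).
have S0 : 0 < S.
  rewrite /S (bigD1 (ordS a)) //= ltr_pwDl ?sumr_ge0 // dT //.
  by case: a {da dT} => [[|[|[]]]].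
have [sd vd] := dd; move: sd vd; rewrite !big_sumType /= => sd vd.
exists (\sum_k (S^-1 * d (inl k)) *: T k).
have vU : \sum_k (S^-1 * d (inl k)) *: T k =
          \sum_k (- (S^-1 * d (inr k))) *: U k.
  under eq_bigr do rewrite -scalerA.
  under [RHS]eq_bigr do rewrite scaleNr -scalerA.
  rewrite sumrN -!scaler_sumr -scalerN; congr (_ *: _).
  by apply/eqP; rewrite -addr_eq0 vd.
apply/seteqP; split=> x.
  move=> [/outlineP[w [w0 w1 xw [k wk]]] [v [v0 v1 xv]]].
  pose g i := match i with inl i => w i | inr i => - v i end.
  have dg : affine_dep q g.
    rewrite /affine_dep !big_sumType /= sumrN w1 v1 subrr -xw; split => //.
    by under eq_bigr do rewrite scaleNr; rewrite sumrN -xv subrr.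
  (* y and z make g agree with y c + z d at inl a, where d = 0, and at inr b,
     where c = 0; their difference then has two zeros. *)
  pose y := w a / c (inl a); pose z := - v b / d (inr b).
  have y0 : 0 <= y by rewrite /y divr_ge0 // ltW.
  have z0 : 0 <= z by rewrite /z mulNr -mulrN -invrN divr_ge0 // oppr_ge0 ltW.
  have gE i : g i = y * c i + z * d i.
    apply/eqP; rewrite -subr_eq0; apply/eqP.
    pose e i := 1 * g i + (-1) * (y * c i + z * d i).
    have -> : g i - (y * c i + z * d i) = e i by rewrite /e; ring.
    apply: (@affine_dep_two_zeros _ _ q e (inl a) (inr b)) => //.
    - by rewrite card_sum !card_ord.
    - by apply: affine_dep_comb => //; apply: affine_dep_comb.
    - by rewrite /e /= da mulr0 addr0 /y divfK ?gt_eqF //; ring.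
    - by rewrite /e /= cb mulr0 add0r /z divfK ?lt_eqF //; ring.
  move: y z y0 z0 gE => y z y0 z0 gE.
  have yk : y = 0.
    have := gE (inl k); rewrite /= wk => /esym/eqP.
    rewrite paddr_eq0 ?mulr_ge0 // ?(ltW (cT k)) // => /andP[].
    by rewrite mulf_eq0 (gt_eqF (cT k)) orbF => /eqP.
  have wE i : w i = z * d (inl i) by have := gE (inl i); rewrite yk mul0r add0r.
  have zS : z = S^-1.
    apply: (mulIf (lt0r_neq0 S0)); rewrite mulVf ?gt_eqF // -w1 mulr_sumr.
    by apply: eq_bigr => i _; rewrite wE.
  by rewrite xw -zS; apply: eq_bigr => i _; rewrite wE.
move=> ->; split.
  apply/outlineP; exists (fun k => S^-1 * d (inl k)); split => //.
  - by move=> k; rewrite mulr_ge0 // invr_ge0 ltW.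
  - by rewrite -mulr_sumr mulVf // gt_eqF.
  - by exists a; rewrite da mulr0.
exists (fun k => - (S^-1 * d (inr k))); split => //.
- by move=> k; rewrite -mulrN mulr_ge0 ?invr_ge0 ?oppr_ge0 // ltW.
- rewrite sumrN -mulr_sumr -mulrN.
  have -> : - (\sum_k d (inr k)) = S by apply/eqP; rewrite eq_sym -addr_eq0 sd.
  by rewrite mulVf // gt_eqF.
Qed.

Lemma card_enum_set (I : finType) (n : nat) (A : {set I}) :
  #|A| = n -> exists t : 'I_n -> I,
    injective t /\ forall k, k \in A <-> exists i, t i = k.
Proof.
move=> <-; exists enum_val; split; first exact: enum_val_inj.
move=> k; split=> [kA | [i <-]]; last exact: enum_valP.
by exists (enum_rank_in kA k); rewrite enum_rankK_in.
Qed.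

Theorem theorem1p2 (R : realType) (p : 'I_6 -> 'rV[R]_3)
    (hp : no_four_coplanar p) :
  exists t u : 'I_3 -> 'I_6,
    [/\ injective t, injective u, (forall i j, t i <> u j)
      & linked (fun i => p (t i)) (fun j => p (u j))].
Proof.
have [c [s [dc ds s0 injr sneg]]] := affine_dep_few_neg hp (card_ord 6).
set r := fun k => c k / s k in injr.
have spos : (3 < #|[set k | (0 < s k)%R]|)%N.
  have := card_sign s; rewrite card_ord.
  have -> : [set k | s k == 0] = finset.set0.
    by apply/setP => k; rewrite !inE (negPf (s0 k)).
  by rewrite cards0; move: sneg; move: #|_| #|_| => x y; lia.
have [i [j [PiE iPj cPj]]] := sign_crossing injr sneg spos.
set Pi := [set k | _] in PiE; set Pj := [set k | _] in PiE iPj cPj.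
(* The member of the pencil that vanishes at l. *)
pose g l k := 1 * c k + (- r l) * s k.
have gE l k : g l k = s k * (r k - r l).
  by rewrite /g /r; field; rewrite !s0.
have dg l : affine_dep p (g l) by exact: affine_dep_comb.
have jPj : j \notin Pj by rewrite inE subrr mulr0 ltxx.
have cPi : #|Pi| = 3 by rewrite PiE cardsU1 jPj cPj.
have cPiC : #|~: Pi| = 3.
  by have := cardsC Pi; rewrite card_ord cPi => /(@addnI 3 _ 3).
have [t [injt tP]] := card_enum_set cPi.
have [u [inju uP]] := card_enum_set cPiC.
have tu k l : t k <> u l.
  move=> tul; have : u l \in ~: Pi by apply/uP; exists l.
  by rewrite inE -tul; case/negP; apply/tP; exists k.
(* T is P i, which contains j; U is its complement, which contains i. *)
exists t, u; split => //.
pose f (x : 'I_3 + 'I_3) := match x with inl k => t k | inr k => u k end.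
have bijf : bijective f.
  apply: inj_card_bij; last by rewrite card_sum !card_ord.
  move=> [k|k] [l|l] /=;
    [by move/injt-> | by move/tu | by move/esym/tu | by move/inju->].
pose q := six_vertices (fun i => p (t i)) (fun j => p (u j)).
have qE : q =1 p \o f by case.
have dq l : affine_dep q (g l \o f).
  have [sg vg] := affine_dep_bij bijf (dg l); split=> //.
  by under eq_bigr do rewrite qE.
have /tP[a ta] : j \in Pi by rewrite PiE setU11.
have /uP[b ub] : i \in ~: Pi by rewrite !inE subrr mulr0 ltxx.
have tPi k : t k \in Pi by apply/tP; exists k.
have uPi k : u k \in ~: Pi by apply/uP; exists k.
apply: (linked_of_deps (a := a) (b := b) (c := g i \o f) (d := g j \o f)) => //=.
- exact: no_four_coplanar_inj (bij_inj bijf) qE hp.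
- by move=> k; have := tPi k; rewrite inE gE.
- by rewrite ub gE subrr mulr0.
- by rewrite ta gE subrr mulr0.
- move=> k ka; have := tPi k; rewrite PiE !inE -ta (inj_eq injt) (negPf ka) /=.
  by rewrite gE ta.
move=> k; have := uPi k; rewrite inE PiE !inE negb_or -leNgt -gE => /andP[kj].
rewrite le_eqVlt gE mulf_eq0 (negPf (s0 _)) subr_eq0.
by rewrite (inj_eq injr) (negPf kj).
Qed.
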